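(* Let $\Xi$ be a Hausdorff locally compact $\sigma$-compact groupoid with unit space $X$, endowed with a right Haar system and a continuous $2$-cocycle $\omega$. Let $\Sigma$ be a $C^*$-algebraic spectral set. Let $F\in{\sf C}^*_{\rm r}(\Xi,\omega)^{\bf M}$ (the multiplier algebra of the reduced twisted groupoid $C^*$-algebra). For every closed invariant subsets $A,B\subset X$ with $B\supset A$ one has $$\Sigma(F_B)\supset\Sigma(F_A)\,,$$ where $F_B:=\rho_B^{\bf M}(F)\in{\sf C}^*_{\rm r}(\Xi_B,\omega_B)^{\bf M}$ and $F_A:=\rho_A^{\bf M}(F)\in{\sf C}^*_{\rm r}(\Xi_A,\omega_A)^{\bf M}$.
   Context: A $C^*$-algebraic spectral set $\Sigma$ assigns to every unital $C^*$-algebra $\mathscr E$ and every $E\in\mathscr E$ a closed subset $\Sigma(E\mid\mathscr E)\subset\mathbb C$ such that for every unital $*$-morphism $\pi:\mathscr E\to\mathscr F$ one has $\Sigma(\pi(E)\mid\mathscr F)\subset\Sigma(E\mid\mathscr E)$ for all $E\in\mathscr E$, with equality if $\pi$ is injective. Here $\Sigma(F_B)$ means $\Sigma$ of $F_B$ computed in the unital $C^*$-algebra ${\sf C}^*_{\rm r}(\Xi_B,\omega_B)^{\bf M}$, and similarly for $A$. Groupoid conventions: ${\rm d},{\rm r}:\Xi\to X$ are the source and range maps, $\Xi^{(2)}=\{(\xi,\eta)\mid {\rm d}(\xi)={\rm r}(\eta)\}$ the composable pairs, $\Xi_x={\rm d}^{-1}(\{x\})$, the orbit of $x\in X$ is $\mathcal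 O_x={\rm r}(\Xi_x)$; $A\subset X$ is invariant if $\mathcal O_x\subset A$ for all $x\in A$. A right Haar system is a family of positive regular Borel measures $\{\lambda_x\mid x\in X\}$ with $\lambda_x$ of full support on $\Xi_x$, such that $x\mapsto\int_{\Xi_x} f\,d\lambda_x$ is continuous for every $f\in C_{\rm c}(\Xi)$, and such that for each $\xi\in\Xi$ the homeomorphism $\Xi_{{\rm r}(\xi)}\ni\eta\mapsto\eta\xi\in\Xi_{{\rm d}(\xi)}$ transports $\lambda_{{\rm r}(\xi)}$ to $\lambda_{{\rm d}(\xi)}$. A continuous $2$-cocycle is a continuous $\omega:\Xi^{(2)}\to\mathbb T$ with $\omega(\xi,\eta)\omega(\xi\eta,\zeta)=\omega(\eta,\zeta)\omega(\xi,\eta\zeta)$ for $(\xi,\eta),(\eta,\zeta)\in\Xi^{(2)}$ and $\omega(x,\eta)=1=\omega(\xi,x)$ whenever $x\in X$, ${\rm r}(\eta)=x={\rm d}(\xi)$. $C_{\rm c}(\Xi)$ is a $*$-algebra with $(f\star_\omega g)(\xi)=\int_{\Xi}f(\xi\eta^{-1})g(\eta)\,\omega(\xi\eta^{-1},\eta)\,d\lambda_{{\rm d}(\xi)}(\eta)$ and $f^{\star_\omega}(\xi)=\overline{\omega(\xi,\xi^{-1})}\,\overline{f(\xi^{-1})}$. The regular representation at $x$ is $\Pi_x(f)u:=f\star_\omega u$ on $L^2(\Xi_x;\lambda_x)$, and ${\sf C}^*_{\rm r}(\Xi,\omega)$ is the completion of $C_{\rm c}(\Xi)$ in the norm $\|f\|=\sup_{x\in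 X}\|\Pi_x(f)\|$. For a closed invariant $A\subset X$, $\Xi_A={\rm d}^{-1}(A)={\rm r}^{-1}(A)$ is the reduced groupoid over $A$ (with restricted Haar system), $\omega_A$ is the restriction of $\omega$ to $\Xi_A^{(2)}$, and $\rho_A:{\sf C}^*_{\rm r}(\Xi,\omega)\to{\sf C}^*_{\rm r}(\Xi_A,\omega_A)$ is the surjective $*$-morphism extending the restriction map $C_{\rm c}(\Xi)\ni f\mapsto f|_{\Xi_A}\in C_{\rm c}(\Xi_A)$. A surjective $*$-morphism $\Phi:\mathscr C\to\mathscr D$ extends uniquely to a $*$-morphism $\Phi^{\bf M}:\mathscr C^{\bf M}\to\mathscr D^{\bf M}$ of multiplier algebras. *)

(* Defs.v *)
From HB Require Import structures.
From mathcomp Require Import all_boot all_order all_algebra.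
From mathcomp Require Import complex.
From mathcomp Require Import all_classical all_reals all_analysis.

Set Implicit Arguments.
Unset Strict Implicit.
Unset Printing Implicit Defensive.

Import Order.TTheory GRing.Theory Num.Theory.
Import numFieldNormedType.Exports.

Local Open Scope classical_set_scope.
Local Open Scope ring_scope.
Local Open Scope complex_scope.

Declare Scope cstar_scope.
Delimit Scope cstar_scope with cstar.
Reserved Notation "a ** b" (at level 40, left associativity).

(* The scalars of [T] are complex, so that the norm of [completeNormedModType]
   takes its values in [R[i]]; they are nonnegative, hence real. No unit is
   required, and the zero algebra is allowed (it is needed for the reduction of
   a groupoid to the empty set). *)
HB.mixin Record isCstarAlgebra (R : realType) T & CompleteNormedModule R[i] T := {
  cmul : T -> T -> T ;
  cstar : T -> T ;
  cmulA : associative cmul ;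
  cmulDl : left_distributive cmul +%R ;
  cmulDr : right_distributive cmul +%R ;
  cmulZl : forall (l : R[i]) (a b : T), cmul (l *: a) b = l *: cmul a b ;
  cmulZr : forall (l : R[i]) (a b : T), cmul a (l *: b) = l *: cmul a b ;
  cnormM : forall a b : T, `|cmul a b| <= `|a| * `|b| ;
  cstarK : involutive cstar ;
  cstarD : {morph cstar : a b / a + b} ;
  cstarZ : forall (l : R[i]) (a : T), cstar (l *: a) = l^* *: cstar a ;
  cstarM : forall a b : T, cstar (cmul a b) = cmul (cstar b) (cstar a) ;
  cnorm_star : forall a : T, `|cmul (cstar a) a| = `|a| ^+ 2
}.

#[short(type="cstarType")]
HB.structure Definition CstarAlgebra (R : realType) :=
  {T of isCstarAlgebra R T & CompleteNormedModule R[i] T}.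

HB.mixin Record isUnitalCstarAlgebra (R : realType) T & CstarAlgebra R T := {
  cone : T ;
  cmul1l : left_id cone cmul ;
  cmul1r : right_id cone cmul
}.

#[short(type="unitalCstarType")]
HB.structure Definition UnitalCstarAlgebra (R : realType) :=
  {T of isUnitalCstarAlgebra R T & CstarAlgebra R T}.

Notation "a ** b" := (cmul a b) : cstar_scope.
Local Open Scope cstar_scope.

Definition star_morphism (R : realType) (A B : cstarType R) (f : A -> B) : Prop :=
  [/\ linear f, {morph f : a b / a ** b} & {morph f : a / cstar a}].

Definition unital_star_morphism (R : realType) (A B : unitalCstarType R)
    (f : A -> B) : Prop :=
  star_morphism f /\ f cone = cone.

Record spectral_set (R : realType) := SpectralSet {
  spectrum :> forall E : unitalCstarType R, E -> set R[i]^o ;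
  spectrum_closed : forall (E : unitalCstarType R) (a : E), closed (spectrum a) ;
  spectrum_morphism : forall (E F : unitalCstarType R) (pi : E -> F),
    unital_star_morphism pi ->
    forall a : E, spectrum (pi a) `<=` spectrum a ;
  spectrum_injective : forall (E F : unitalCstarType R) (pi : E -> F),
    unital_star_morphism pi -> injective pi ->
    forall a : E, spectrum (pi a) = spectrum a
}.

(* The multiplier algebra is constructed as the algebra of double centralizers
   [(L, R)], with the norm [||L||] (which is also [||R||]). *)

Definition bounded_map (R : realType) (A B : cstarType R) (f : A -> B) : Prop :=
  exists M : R, forall a, `|f a| <= M%:C * `|a|.

Record multiplier (R : realType) (A : cstarType R) := Multiplier {
  lmult : A -> A ;
  rmult : A -> A ;
  lmult_linear : linear lmult ;
  rmult_linear : linear rmult ;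
  lmult_bounded : bounded_map lmult ;
  rmult_bounded : bounded_map rmult ;
  lmultM : forall a b, lmult (a ** b) = lmult a ** b ;
  rmultM : forall a b, rmult (a ** b) = a ** rmult b ;
  lrmult : forall a b, a ** lmult b = rmult a ** b
}.

Section Norm.
Context {R : realType}.

Definition rnorm (V : normedModType R[i]) (x : V) : R := complex.Re `|x|.

Definition opnorm (A B : cstarType R) (f : A -> B) : R :=
  sup [set rnorm (f a) | a in [set a | rnorm a <= 1]].

Section RealNorm.
Variable V : normedModType R[i].
Implicit Types x y : V.

Lemma rnormE x : `|x| = (rnorm x)%:C.
Proof.
rewrite /rnorm; have := normr_ge0 x; rewrite lecE => /andP[/eqP /= h _].
by move: h; case: (`|x|) => a b /= ->.
Qed.

Lemma rnorm_ge0 x : 0 <= rnorm x.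
Proof. by rewrite -ler0c -rnormE. Qed.

Lemma rnormD x y : rnorm (x + y) <= rnorm x + rnorm y.
Proof. by rewrite -lecR rmorphD/= -!rnormE ler_normD. Qed.

Lemma rnormZ (l : R[i]) x : rnorm (l *: x) = complex.Re `|l| * rnorm x.
Proof. by rewrite {1}/rnorm normrZ rnormE; case: (`|l|) => a b /=; rewrite mulr0 subr0. Qed.

Lemma rnorm0_eq0 x : rnorm x = 0 -> x = 0.
Proof. by move=> x0; apply: normr0_eq0; rewrite rnormE x0. Qed.

Lemma rnorm0 : rnorm (0 : V) = 0.
Proof. by rewrite /rnorm normr0. Qed.

Lemma rnormN x : rnorm (- x) = rnorm x.
Proof. by rewrite /rnorm normrN. Qed.
End RealNorm.

Section OpNorm.
Variables A B : cstarType R.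
Implicit Types f g : A -> B.

Lemma bounded_mapP f :
  bounded_map f <-> exists2 M : R, 0 <= M & forall a, rnorm (f a) <= M * rnorm a.
Proof.
split=> [[M fM]|[M M0 fM]]; last first.
  by exists M => a; rewrite !rnormE -rmorphM lecR.
exists (Num.max M 0) => [|a]; first by rewrite le_max lexx orbT.
have := fM a; rewrite !rnormE -rmorphM lecR => /le_trans; apply.
by rewrite ler_wpM2r ?rnorm_ge0// le_max lexx.
Qed.

Lemma opnorm_ge0 f : 0 <= opnorm f.
Proof.
rewrite /opnorm; set S := [set _ | _ in _].
have [supS|nsup] := pselect (has_sup S); last by rewrite sup_out.
apply: (le_trans (rnorm_ge0 (f 0))); apply: (sup_upper_bound supS).
by exists 0 => //=; rewrite rnorm0.
Qed.

Lemma opnorm_le f (M : R) : 0 <= M ->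
  (forall a, rnorm (f a) <= M * rnorm a) -> opnorm f <= M.
Proof.
move=> M0 fM; apply: ge_sup.
  by exists (rnorm (f 0)), 0 => //=; rewrite rnorm0.
move=> _ [a /= a1 <-]; apply: (le_trans (fM a)).
by rewrite -[leRHS]mulr1 ler_wpM2l.
Qed.

Lemma le_opnorm f : linear f -> bounded_map f ->
  forall a, rnorm (f a) <= opnorm f * rnorm a.
Proof.
move=> lf /bounded_mapP[M M0 fM] a.
have fZ l x : f (l *: x) = l *: f x.
  have f0 : f 0 = 0 by have := lf (-1) 0 0; rewrite !scaleN1r oppr0 addr0 addNr.
  by have := lf l x 0; rewrite f0 !addr0.
have [a0|a0] := eqVneq (rnorm a) 0.
  by have := fM a; rewrite a0 !mulr0.
have ap : 0 < rnorm a by rewrite lt_neqAle eq_sym a0 rnorm_ge0.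
have nl : complex.Re `|((rnorm a)^-1)%:C : R[i]| = (rnorm a)^-1.
  by rewrite ger0_norm// ler0c invr_ge0 ltW.
rewrite -ler_pdivrMr// mulrC -nl -rnormZ -fZ.
apply: ub_le_sup.
  exists M => _ [b /= b1 <-]; apply: (le_trans (fM b)).
  by rewrite -[leRHS]mulr1 ler_wpM2l.
by eexists; last reflexivity; rewrite /= rnormZ nl mulVf.
Qed.

End OpNorm.
End Norm.

Section CstarLemmas.
Context {R : realType} {A : cstarType R}.
Implicit Types a b : A.

Lemma rnormM a b : rnorm (a ** b) <= rnorm a * rnorm b.
Proof. by rewrite -lecR rmorphM/= -!rnormE cnormM. Qed.

Lemma rnorm_star_mul a : rnorm (cstar a ** a) = rnorm a ^+ 2.
Proof. by apply: complexI; rewrite rmorphXn/= -!rnormE cnorm_star. Qed.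

Lemma rnorm_star a : rnorm (cstar a) = rnorm a.
Proof.
suff le b : rnorm b <= rnorm (cstar b).
  by apply/eqP; rewrite eq_le le -{2}[a]cstarK le.
have [->|b0] := eqVneq (rnorm b) 0; first exact: rnorm_ge0.
have bp : 0 < rnorm b by rewrite lt_neqAle eq_sym b0 rnorm_ge0.
by rewrite -(ler_pM2r bp) -expr2 -rnorm_star_mul rnormM.
Qed.

Lemma rnorm_mul_star a : rnorm (a ** cstar a) = rnorm a ^+ 2.
Proof. by rewrite -{1}[a]cstarK rnorm_star_mul rnorm_star. Qed.

Lemma cmul0l a : 0 ** a = 0.
Proof. by have := cmulZl 0 a a; rewrite !scale0r. Qed.

Lemma cmul0r a : a ** 0 = 0.
Proof. by have := cmulZr 0 a a; rewrite !scale0r. Qed.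

Lemma cmulNl a b : (- a) ** b = - (a ** b).
Proof. by have := cmulZl (-1) a b; rewrite !scaleN1r. Qed.

Lemma cmulNr a b : a ** (- b) = - (a ** b).
Proof. by have := cmulZr (-1) a b; rewrite !scaleN1r. Qed.

Lemma cmulBl a b c : (a - b) ** c = a ** c - b ** c.
Proof. by rewrite cmulDl cmulNl. Qed.

Lemma cmulBr a b c : a ** (b - c) = a ** b - a ** c.
Proof. by rewrite cmulDr cmulNr. Qed.

End CstarLemmas.

Section LinearMaps.
Context {R : realType} {A B : cstarType R}.
Implicit Types f g : A -> B.

Lemma linear_map0 f : linear f -> f 0 = 0.
Proof. by move=> lf; have := lf (-1) 0 0; rewrite !scaleN1r oppr0 addr0 addNr. Qed.

Lemma linear_mapZ f : linear f -> forall l a, f (l *: a) = l *: f a.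
Proof. by move=> lf l a; have := lf l a 0; rewrite (linear_map0 lf) !addr0. Qed.

Lemma linear_mapD f : linear f -> forall a b, f (a + b) = f a + f b.
Proof. by move=> lf a b; have := lf 1 a b; rewrite !scale1r. Qed.

Lemma linear_mapB f : linear f -> forall a b, f (a - b) = f a - f b.
Proof. by move=> lf a b; rewrite linear_mapD// -scaleN1r linear_mapZ// scaleN1r. Qed.

Lemma linear_add f g : linear f -> linear g -> linear (fun a => f a + g a).
Proof. by move=> lf lg l a b; rewrite lf lg scalerDr addrACA. Qed.

Lemma linear_scale k f : linear f -> linear (fun a => k *: f a).
Proof. by move=> lf l a b; rewrite lf scalerDr !scalerA mulrC. Qed.

Lemma bounded_add f g :
  bounded_map f -> bounded_map g -> bounded_map (fun a => f a + g a).
Proof.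
move=> /bounded_mapP[M M0 fM] /bounded_mapP[N N0 gN]; apply/bounded_mapP.
exists (M + N) => [|a]; first exact: addr_ge0.
by rewrite (le_trans (rnormD _ _))// mulrDl lerD.
Qed.

Lemma bounded_scale k f : bounded_map f -> bounded_map (fun a => k *: f a).
Proof.
move=> /bounded_mapP[M M0 fM]; apply/bounded_mapP.
have k0 : 0 <= complex.Re `|k| by have := normr_ge0 k; rewrite lecE => /andP[].
exists (complex.Re `|k| * M) => [|a]; first exact: mulr_ge0.
by rewrite rnormZ -mulrA ler_wpM2l.
Qed.

End LinearMaps.

#[local] Obligation Tactic := idtac.

Section MultiplierAlgebra.
Context {R : realType} {A : cstarType R}.
Implicit Types m n : multiplier A.

HB.instance Definition _ := gen_eqMixin (multiplier A).
HB.instance Definition _ := gen_choiceMixin (multiplier A).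

Lemma multiplierP m n : lmult m =1 lmult n -> rmult m =1 rmult n -> m = n.
Proof.
move=> /funext + /funext; case: m n => [l r ? ? ? ? ? ? ?] [l' r' ? ? ? ? ? ? ?] /= ll rr.
by subst l' r'; congr Multiplier; exact: Prop_irrelevance.
Qed.

Program Definition mult_zero : multiplier A :=
  @Multiplier R A (fun=> 0) (fun=> 0) _ _ _ _ _ _ _.
Next Obligation. by move=> l a b; rewrite scaler0 addr0. Qed.
Next Obligation. by move=> l a b; rewrite scaler0 addr0. Qed.
Next Obligation. by exists 0 => a; rewrite normr0 mul0r. Qed.
Next Obligation. by exists 0 => a; rewrite normr0 mul0r. Qed.
Next Obligation. by move=> a b; rewrite cmul0l. Qed.
Next Obligation. by move=> a b; rewrite cmul0r. Qed.
Next Obligation. by move=> a b; rewrite cmul0r cmul0l. Qed.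

Program Definition mult_add m n : multiplier A :=
  @Multiplier R A (fun a => lmult m a + lmult n a) (fun a => rmult m a + rmult n a)
    _ _ _ _ _ _ _.
Next Obligation. by move=> m n; apply: linear_add; exact: lmult_linear. Qed.
Next Obligation. by move=> m n; apply: linear_add; exact: rmult_linear. Qed.
Next Obligation. by move=> m n; apply: bounded_add; exact: lmult_bounded. Qed.
Next Obligation. by move=> m n; apply: bounded_add; exact: rmult_bounded. Qed.
Next Obligation. by move=> m n a b /=; rewrite !lmultM cmulDl. Qed.
Next Obligation. by move=> m n a b /=; rewrite !rmultM cmulDr. Qed.
Next Obligation. by move=> m n a b /=; rewrite cmulDl cmulDr !lrmult. Qed.

Program Definition mult_scale (l : R[i]) m : multiplier A :=
  @Multiplier R A (fun a => l *: lmult m a) (fun a => l *: rmult m a) _ _ _ _ _ _ _.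
Next Obligation. by move=> l m; apply: linear_scale; exact: lmult_linear. Qed.
Next Obligation. by move=> l m; apply: linear_scale; exact: rmult_linear. Qed.
Next Obligation. by move=> l m; apply: bounded_scale; exact: lmult_bounded. Qed.
Next Obligation. by move=> l m; apply: bounded_scale; exact: rmult_bounded. Qed.
Next Obligation. by move=> l m a b /=; rewrite lmultM cmulZl. Qed.
Next Obligation. by move=> l m a b /=; rewrite rmultM cmulZr. Qed.
Next Obligation. by move=> l m a b /=; rewrite cmulZl cmulZr lrmult. Qed.

Lemma bounded_comp (f g : A -> A) :
  bounded_map f -> bounded_map g -> bounded_map (f \o g).
Proof.
move=> /bounded_mapP[M M0 fM] /bounded_mapP[N N0 gN]; apply/bounded_mapP.
exists (M * N) => [|a]; first exact: mulr_ge0.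
by rewrite (le_trans (fM _))// -mulrA ler_wpM2l.
Qed.

Program Definition mult_mul m n : multiplier A :=
  @Multiplier R A (lmult m \o lmult n) (rmult n \o rmult m) _ _ _ _ _ _ _.
Next Obligation. by move=> m n l a b; rewrite /= !lmult_linear. Qed.
Next Obligation. by move=> m n l a b; rewrite /= !rmult_linear. Qed.
Next Obligation. by move=> m n; apply: bounded_comp; exact: lmult_bounded. Qed.
Next Obligation. by move=> m n; apply: bounded_comp; exact: rmult_bounded. Qed.
Next Obligation. by move=> m n a b; rewrite /= !lmultM. Qed.
Next Obligation. by move=> m n a b; rewrite /= !rmultM. Qed.
Next Obligation. by move=> m n a b; rewrite /= !lrmult. Qed.

Lemma linear_star_conj (f : A -> A) :
  linear f -> linear (fun a => cstar (f (cstar a))).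
Proof.
by move=> lf l a b; rewrite cstarD cstarZ lf cstarD cstarZ conjCK.
Qed.

Lemma bounded_star_conj (f : A -> A) :
  bounded_map f -> bounded_map (fun a => cstar (f (cstar a))).
Proof.
move=> /bounded_mapP[M M0 fM]; apply/bounded_mapP; exists M => // a.
by rewrite rnorm_star (le_trans (fM _))// rnorm_star.
Qed.

Program Definition mult_star m : multiplier A :=
  @Multiplier R A (fun a => cstar (rmult m (cstar a))) (fun a => cstar (lmult m (cstar a)))
    _ _ _ _ _ _ _.
Next Obligation. by move=> m; apply: linear_star_conj; exact: rmult_linear. Qed.
Next Obligation. by move=> m; apply: linear_star_conj; exact: lmult_linear. Qed.
Next Obligation. by move=> m; apply: bounded_star_conj; exact: rmult_bounded. Qed.
Next Obligation. by move=> m; apply: bounded_star_conj; exact: lmult_bounded. Qed.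
Next Obligation. by move=> m a b /=; rewrite cstarM rmultM cstarM cstarK. Qed.
Next Obligation. by move=> m a b /=; rewrite cstarM lmultM cstarM cstarK. Qed.
Next Obligation.
by move=> m a b /=; rewrite -{1}[a]cstarK -cstarM -lrmult cstarM cstarK.
Qed.

Program Definition mult_one : multiplier A :=
  @Multiplier R A id id _ _ _ _ _ _ _.
Next Obligation. by []. Qed.
Next Obligation. by []. Qed.
Next Obligation. by exists 1 => a; rewrite mul1r. Qed.
Next Obligation. by exists 1 => a; rewrite mul1r. Qed.
Next Obligation. by []. Qed.
Next Obligation. by []. Qed.
Next Obligation. by []. Qed.

Lemma mult_addA : associative mult_add.
Proof. by move=> m n p; apply: multiplierP => a /=; rewrite addrA. Qed.

Lemma mult_addC : commutative mult_add.
Proof. by move=> m n; apply: multiplierP => a /=; rewrite addrC. Qed.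

Lemma mult_add0 : left_id mult_zero mult_add.
Proof. by move=> m; apply: multiplierP => a /=; rewrite add0r. Qed.

Lemma mult_addN : left_inverse mult_zero (mult_scale (-1)) mult_add.
Proof. by move=> m; apply: multiplierP => a /=; rewrite scaleN1r addNr. Qed.

HB.instance Definition _ :=
  GRing.isZmodule.Build (multiplier A) mult_addA mult_addC mult_add0 mult_addN.

Lemma mult_scaleA k l m : mult_scale k (mult_scale l m) = mult_scale (k * l) m.
Proof. by apply: multiplierP => a /=; rewrite scalerA. Qed.

Lemma mult_scale1 : left_id 1 mult_scale.
Proof. by move=> m; apply: multiplierP => a /=; rewrite scale1r. Qed.

Lemma mult_scaleDr : right_distributive mult_scale +%R.
Proof. by move=> l m n; apply: multiplierP => a /=; rewrite scalerDr. Qed.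

Lemma mult_scaleDl m : {morph (mult_scale^~ m) : k l / k + l}.
Proof. by move=> k l; apply: multiplierP => a /=; rewrite scalerDl. Qed.

HB.instance Definition _ := GRing.Zmodule_isLmodule.Build R[i] (multiplier A)
  mult_scaleA mult_scale1 mult_scaleDr mult_scaleDl.

Lemma lmultD m n a : lmult (m + n) a = lmult m a + lmult n a.
Proof. by []. Qed.

Lemma rmultD m n a : rmult (m + n) a = rmult m a + rmult n a.
Proof. by []. Qed.

Lemma lmultZ l m a : lmult (l *: m) a = l *: lmult m a.
Proof. by []. Qed.

Lemma rmultZ l m a : rmult (l *: m) a = l *: rmult m a.
Proof. by []. Qed.

Lemma lmultB m n a : lmult (m - n) a = lmult m a - lmult n a.
Proof. by rewrite lmultD -[- n]scaleN1r lmultZ scaleN1r. Qed.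

Lemma rmultB m n a : rmult (m - n) a = rmult m a - rmult n a.
Proof. by rewrite rmultD -[- n]scaleN1r rmultZ scaleN1r. Qed.

Definition mult_norm m : R[i] := (opnorm (lmult m))%:C.

Lemma le_lmult m a : rnorm (lmult m a) <= opnorm (lmult m) * rnorm a.
Proof. by apply: le_opnorm; [exact: lmult_linear | exact: lmult_bounded]. Qed.

Lemma le_rmult m a : rnorm (rmult m a) <= opnorm (lmult m) * rnorm a.
Proof.
have [->|m0] := eqVneq (rnorm (rmult m a)) 0.
  by rewrite mulr_ge0 ?opnorm_ge0 ?rnorm_ge0.
have mp : 0 < rnorm (rmult m a) by rewrite lt_neqAle eq_sym m0 rnorm_ge0.
rewrite -(ler_pM2r mp) -expr2 -rnorm_mul_star -lrmult (le_trans (rnormM _ _))//.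
by rewrite mulrC mulrAC ler_wpM2r ?rnorm_ge0// (le_trans (le_lmult _ _))// rnorm_star.
Qed.

Lemma mult_normD m n : mult_norm (m + n) <= mult_norm m + mult_norm n.
Proof.
rewrite /mult_norm -rmorphD lecR; apply: opnorm_le => [|a].
  by rewrite addr_ge0 ?opnorm_ge0.
by rewrite (le_trans (rnormD _ _))// mulrDl lerD ?le_lmult.
Qed.

Lemma opnorm_scale_le l m :
  opnorm (lmult (l *: m)) <= complex.Re `|l| * opnorm (lmult m).
Proof.
have l0 : 0 <= complex.Re `|l| by have := normr_ge0 l; rewrite lecE => /andP[].
apply: opnorm_le => [|a]; first by rewrite mulr_ge0 ?opnorm_ge0.
by rewrite lmultZ rnormZ -mulrA ler_wpM2l// le_lmult.
Qed.

Lemma mult_normZ l m : mult_norm (l *: m) = `|l| * mult_norm m.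
Proof.
have nl k : (complex.Re `|k : R[i]|)%:C = `|k| by [].
rewrite /mult_norm -nl -rmorphM; congr (_%:C); apply/eqP.
rewrite eq_le opnorm_scale_le andTb.
have [->|l0] := eqVneq l 0.
  suff -> : complex.Re `|0 : R[i]| = 0 by rewrite mul0r opnorm_ge0.
  by apply: complexI; rewrite nl normr0.
have lp : 0 < complex.Re `|l| by rewrite -ltcR nl normr_gt0.
rewrite -ler_pdivlMl//.
have {1}-> : m = l^-1 *: (l *: m) by rewrite scalerA mulVf// scale1r.
apply: (le_trans (opnorm_scale_le _ _)); rewrite normfV.
suff -> : complex.Re (`|l|^-1) = (complex.Re `|l|)^-1 by [].
by apply: complexI; rewrite -normfV nl normfV fmorphV/= nl.
Qed.

Lemma mult_norm_eq0 m : mult_norm m = 0 -> m = 0.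
Proof.
move=> mz; have m0 : opnorm (lmult m) = 0 by exact: complexI mz.
apply: multiplierP => a; apply: rnorm0_eq0; apply/eqP.
  by rewrite eq_le rnorm_ge0 andbT; have := le_lmult m a; rewrite m0 mul0r.
by rewrite eq_le rnorm_ge0 andbT; have := le_rmult m a; rewrite m0 mul0r.
Qed.

HB.instance Definition _ := Lmodule_isNormed.Build R[i] (multiplier A)
  mult_normD mult_normZ mult_norm_eq0.

Lemma multiplier_rnormE m : rnorm m = opnorm (lmult m).
Proof. by []. Qed.

Lemma rnorm_lmult m a : rnorm (lmult m a) <= rnorm m * rnorm a.
Proof. exact: le_lmult. Qed.

Lemma rnorm_rmult m a : rnorm (rmult m a) <= rnorm m * rnorm a.
Proof. exact: le_rmult. Qed.

Lemma multiplier_norm_le m (M : R) : 0 <= M ->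
  (forall a, rnorm (lmult m a) <= M * rnorm a) -> rnorm m <= M.
Proof. exact: opnorm_le. Qed.

Lemma rnorm_ball (V : normedModType R[i]) (x y : V) (e : R) :
  ball x e%:C y <-> rnorm (x - y) < e.
Proof. by rewrite -ball_normE /= rnormE ltcR. Qed.

Lemma cauchy_rnorm (V : normedModType R[i]) (F : set_system V) : ProperFilter F ->
  cauchy F <-> forall e : R, 0 < e -> exists x, F [set y | rnorm (x - y) < e].
Proof.
move=> FF; split=> [/(cauchyP F) Fc e e0|Fc].
  have [|x xF] := Fc e%:C; first by rewrite ltcR.
  by exists x; apply: filterS xF => y /rnorm_ball.
apply/(cauchyP F) => e e0.
have ee : e = (complex.Re e)%:C.
  by move: e0; rewrite ltcE; case: e => x y /= /andP[/eqP ->].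
have [|x xF] := Fc (complex.Re e); first by rewrite -ltcR -ee.
by exists x; rewrite ee; apply: filterS xF => y /rnorm_ball.
Qed.

Lemma cvg_rnorm (V : normedModType R[i]) (F : set_system V) (x : V) : Filter F ->
  F --> x <-> forall e : R, 0 < e -> F [set y | rnorm (x - y) < e].
Proof.
move=> FF; split=> [/cvg_ballP Fx e e0|Fx].
  have := Fx e%:C; rewrite ltcR => /(_ e0).
  by apply: filterS => y /rnorm_ball.
apply/cvg_ballP => e e0.
have ee : e = (complex.Re e)%:C.
  by move: e0; rewrite ltcE; case: e => a b /= /andP[/eqP ->].
have := Fx (complex.Re e); rewrite -ltcR -ee => /(_ e0).
by rewrite ee; apply: filterS => y /rnorm_ball.
Qed.

Lemma cauchy_pointwise (act : multiplier A -> A -> A) (F : set_system (multiplier A)) :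
  ProperFilter F -> cauchy F ->
  (forall m n a, rnorm (act m a - act n a) <= rnorm (m - n) * rnorm a) ->
  exists f : A -> A, forall e : R, 0 < e ->
    F [set m | forall a, rnorm (act m a - f a) <= e * rnorm a].
Proof.
move=> FF /cauchy_rnorm Fc actB.
have Fa a : exists y : A, act ^~ a @ F --> y.
  exists (lim (act ^~ a @ F)); apply: cauchy_cvg; apply/cauchy_rnorm => e e0.
  have a1 : 0 < rnorm a + 1 by rewrite ltr_wpDl// rnorm_ge0.
  have [|m mF] := Fc (e / (rnorm a + 1)); first exact: divr_gt0.
  exists (act m a); suff : F [set n | rnorm (act m a - act n a) < e] by [].
  apply: filterS mF => n /= mn; apply: (le_lt_trans (actB _ _ _)).
  have [a0|a0] := eqVneq (rnorm a) 0; first by rewrite a0 mulr0.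
  have ap : 0 < rnorm a by rewrite lt_neqAle eq_sym a0 rnorm_ge0.
  rewrite -ltr_pdivlMr// (lt_le_trans mn)// ler_pM2l//.
  by rewrite lef_pV2 ?posrE// lerDl.
have [f fF] := choice Fa; exists f => e e0.
have [|m0 mF] := Fc (e / 2); first exact: divr_gt0.
apply: filterS (mF) => m /= mm0 a.
apply/ler_addgt0Pl => d d0.
have /cvg_rnorm/(_ _ d0) fd := fF a.
have {}fd : F [set n | rnorm (f a - act n a) < d] by [].
have [n [/= nm0 nd]] := filter_ex (filterI mF fd).
rewrite -(subrK (act n a) (act m a)) -addrA (le_trans (rnormD _ _))// [leLHS]addrC lerD//.
  by rewrite -rnormN opprB ltW.
apply: (le_trans (actB _ _ _)); rewrite ler_wpM2r ?rnorm_ge0//.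
rewrite -(subrK m0 m) -addrA (le_trans (rnormD _ _))// (splitr e) lerD ?ltW//.
by rewrite -rnormN opprB.
Qed.

Lemma approx_cvg (act : multiplier A -> A -> A) (F : set_system (multiplier A))
    (f : A -> A) : ProperFilter F ->
  (forall e : R, 0 < e -> F [set m | forall a, rnorm (act m a - f a) <= e * rnorm a]) ->
  forall a, act ^~ a @ F --> f a.
Proof.
move=> FF fF a; apply/cvg_rnorm => e e0.
have a1 : 0 < rnorm a + 1 by rewrite ltr_wpDl// rnorm_ge0.
suff : F [set m | rnorm (f a - act m a) < e] by [].
apply: filterS (fF (e / (rnorm a + 1)) (divr_gt0 e0 a1)) => m /(_ a) /= ma.
rewrite -rnormN opprB (le_lt_trans ma)// mulrAC ltr_pdivrMr// ltr_pM2l//.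
by rewrite ltrDl.
Qed.

Lemma cvg_cmull (T : Type) (F : set_system T) (u : T -> A) (x b : A) : Filter F ->
  u @ F --> x -> (fun t => u t ** b) @ F --> x ** b.
Proof.
move=> FF /cvg_rnorm ux; apply/cvg_rnorm => e e0.
have b1 : 0 < rnorm b + 1 by rewrite ltr_wpDl// rnorm_ge0.
have {}ux : F [set t | rnorm (x - u t) < e / (rnorm b + 1)] by exact: (ux _ (divr_gt0 e0 b1)).
suff : F [set t | rnorm (x ** b - u t ** b) < e] by [].
apply: filterS ux => t /= ut.
rewrite -cmulBl (le_lt_trans (rnormM _ _))//.
apply: (@le_lt_trans _ _ (rnorm (x - u t) * (rnorm b + 1))).
  by rewrite ler_wpM2l ?rnorm_ge0// lerDl.
by rewrite -ltr_pdivlMr.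
Qed.

Lemma cvg_cmulr (T : Type) (F : set_system T) (u : T -> A) (x b : A) : Filter F ->
  u @ F --> x -> (fun t => b ** u t) @ F --> b ** x.
Proof.
move=> FF /cvg_rnorm ux; apply/cvg_rnorm => e e0.
have b1 : 0 < rnorm b + 1 by rewrite ltr_wpDl// rnorm_ge0.
have {}ux : F [set t | rnorm (x - u t) < e / (rnorm b + 1)] by exact: (ux _ (divr_gt0 e0 b1)).
suff : F [set t | rnorm (b ** x - b ** u t) < e] by [].
apply: filterS ux => t /= ut.
rewrite -cmulBr (le_lt_trans (rnormM _ _))// mulrC.
apply: (@le_lt_trans _ _ (rnorm (x - u t) * (rnorm b + 1))).
  by rewrite ler_wpM2l ?rnorm_ge0// lerDl.
by rewrite -ltr_pdivlMr.
Qed.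

Lemma multiplier_complete (F : set_system (multiplier A)) :
  ProperFilter F -> cauchy F -> cvg F.
Proof.
move=> FF Fc.
have lB m n a : rnorm (lmult m a - lmult n a) <= rnorm (m - n) * rnorm a.
  by rewrite -lmultB rnorm_lmult.
have rB m n a : rnorm (rmult m a - rmult n a) <= rnorm (m - n) * rnorm a.
  by rewrite -rmultB rnorm_rmult.
have [l lF] := cauchy_pointwise FF Fc lB.
have [r rF] := cauchy_pointwise FF Fc rB.
have lc := approx_cvg FF lF; have rc := approx_cvg FF rF.
have uniq (u : multiplier A -> A) (x y : A) : u @ F --> x -> u @ F --> y -> x = y.
  by move=> ux uy; refine (@norm_cvg_unique _ A (u @ F) _ x y ux uy).
have lin (act : multiplier A -> A -> A) (f : A -> A) : (forall m, linear (act m)) ->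
    (forall a, act ^~ a @ F --> f a) -> linear f.
  move=> actl af k a b; apply: (uniq _ _ _ (af _)).
  under eq_fun do rewrite actl.
  apply: cvgD; last exact: af.
  by apply: cvgZl_tmp; exact: af.
have bnd (act : multiplier A -> A -> A) (f : A -> A) :
    (forall m a, rnorm (act m a) <= rnorm m * rnorm a) ->
    (forall e : R, 0 < e -> F [set m | forall a, rnorm (act m a - f a) <= e * rnorm a]) ->
    bounded_map f.
  move=> actB af; have [m /= mf] := filter_ex (af 1 ltr01).
  apply/bounded_mapP; exists (1 + rnorm m) => [|a]; first by rewrite addr_ge0 ?rnorm_ge0.
  rewrite -(subrK (act m a) (f a)) mulrDl (le_trans (rnormD _ _))// lerD//.
  by rewrite -rnormN opprB mf.
pose m := @Multiplier R A l r.
have H1 := lin _ _ (@lmult_linear R A) lc.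
have H2 := lin _ _ (@rmult_linear R A) rc.
have H3 := bnd _ _ rnorm_lmult lF.
have H4 := bnd _ _ rnorm_rmult rF.
have H5 a b : l (a ** b) = l a ** b.
  apply: (uniq _ _ _ (lc _)); under eq_fun do rewrite lmultM.
  exact: cvg_cmull.
have H6 a b : r (a ** b) = a ** r b.
  apply: (uniq _ _ _ (rc _)); under eq_fun do rewrite rmultM.
  exact: cvg_cmulr.
have H7 a b : a ** l b = r a ** b.
  apply: (@uniq (fun m => a ** lmult m b)); first exact: cvg_cmulr.
  under eq_fun do rewrite lrmult.
  exact: cvg_cmull.
apply/cvg_ex; exists (Multiplier H1 H2 H3 H4 H5 H6 H7).
apply/cvg_rnorm => e e0; have e2 : 0 < e / 2 by exact: divr_gt0.
apply: filterS (lF _ e2) => p /= pl.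
rewrite -rnormN opprB (@le_lt_trans _ _ (e / 2))//; last first.
  by rewrite ltr_pdivrMr// ltr_pMr// ltr1n.
by apply: multiplier_norm_le => [|a]; [exact: ltW | rewrite lmultB /=].
Qed.

HB.instance Definition _ :=
  Uniform_isComplete.Build (multiplier A) multiplier_complete.

Lemma mult_mulA : associative mult_mul.
Proof. by move=> m n p; exact: multiplierP. Qed.

Lemma mult_mulDl : left_distributive mult_mul +%R.
Proof.
move=> m n p; apply: multiplierP => a //=.
by rewrite (linear_mapD (@rmult_linear _ _ p)).
Qed.

Lemma mult_mulDr : right_distributive mult_mul +%R.
Proof.
move=> m n p; apply: multiplierP => a //=.
by rewrite (linear_mapD (@lmult_linear _ _ m)).
Qed.

Lemma mult_mulZl l m n : mult_mul (l *: m) n = l *: mult_mul m n.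
Proof.
apply: multiplierP => a //=.
by rewrite (linear_mapZ (@rmult_linear _ _ n)).
Qed.

Lemma mult_mulZr l m n : mult_mul m (l *: n) = l *: mult_mul m n.
Proof.
apply: multiplierP => a //=.
by rewrite (linear_mapZ (@lmult_linear _ _ m)).
Qed.

Lemma mult_normM m n : `|mult_mul m n| <= `|m| * `|n|.
Proof.
rewrite !rnormE -rmorphM lecR; apply: multiplier_norm_le => [|a].
  by rewrite mulr_ge0 ?rnorm_ge0.
rewrite /= (le_trans (rnorm_lmult _ _))// -mulrA ler_wpM2l ?rnorm_ge0//.
exact: rnorm_lmult.
Qed.

Lemma mult_starK : involutive mult_star.
Proof. by move=> m; apply: multiplierP => a /=; rewrite !cstarK. Qed.

Lemma mult_starD : {morph mult_star : m n / m + n}.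
Proof. by move=> m n; apply: multiplierP => a /=; rewrite cstarD. Qed.

Lemma mult_starZ (l : R[i]) m : mult_star (l *: m) = l^* *: mult_star m.
Proof. by apply: multiplierP => a /=; rewrite cstarZ. Qed.

Lemma mult_starM m n : mult_star (mult_mul m n) = mult_mul (mult_star n) (mult_star m).
Proof. by apply: multiplierP => a /=; rewrite cstarK. Qed.

Lemma rnorm_mult_star m : rnorm (mult_star m) <= rnorm m.
Proof.
apply: multiplier_norm_le => [|a /=]; first exact: rnorm_ge0.
by rewrite rnorm_star (le_trans (rnorm_rmult _ _))// rnorm_star.
Qed.

Lemma mult_norm_star m : `|mult_mul (mult_star m) m| = `|m| ^+ 2.
Proof.
apply/eqP; rewrite eq_le; apply/andP; split.
  apply: (le_trans (mult_normM _ _)); rewrite expr2 ler_wpM2r//.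
  by rewrite !rnormE lecR rnorm_mult_star.
rewrite !rnormE -rmorphXn lecR; set N := rnorm (mult_mul _ _).
have N0 : 0 <= N by exact: rnorm_ge0.
rewrite -(sqr_sqrtr N0) ler_pXn2r ?nnegrE ?rnorm_ge0 ?sqrtr_ge0//.
apply: multiplier_norm_le => [|a]; first exact: sqrtr_ge0.
rewrite -(@ler_pXn2r _ 2) ?nnegrE ?mulr_ge0 ?rnorm_ge0 ?sqrtr_ge0//.
rewrite exprMn sqr_sqrtr// -rnorm_star_mul lrmult expr2 mulrA.
rewrite (le_trans (rnormM _ _))// ler_wpM2r ?rnorm_ge0//.
rewrite -rnorm_star; exact: (rnorm_lmult (mult_mul (mult_star m) m)).
Qed.

HB.instance Definition _ := isCstarAlgebra.Build R (multiplier A)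
  mult_mulA mult_mulDl mult_mulDr mult_mulZl mult_mulZr mult_normM
  mult_starK mult_starD mult_starZ mult_starM mult_norm_star.

Lemma mult_mul1l : left_id mult_one mult_mul.
Proof. by move=> m; exact: multiplierP. Qed.

Lemma mult_mul1r : right_id mult_one mult_mul.
Proof. by move=> m; exact: multiplierP. Qed.

HB.instance Definition _ :=
  isUnitalCstarAlgebra.Build R (multiplier A) mult_mul1l mult_mul1r.

Lemma cmul_linearl a : linear (cmul a : A -> A).
Proof. by move=> l b c; rewrite cmulDr cmulZr. Qed.

Lemma cmul_linearr a : linear (fun b : A => b ** a).
Proof. by move=> l b c; rewrite cmulDl cmulZl. Qed.

Lemma cmul_boundedl a : bounded_map (cmul a : A -> A).
Proof. by apply/bounded_mapP; exists (rnorm a) => [|b]; [exact: rnorm_ge0 | exact: rnormM]. Qed.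

Lemma cmul_boundedr a : bounded_map (fun b : A => b ** a).
Proof.
by apply/bounded_mapP; exists (rnorm a) => [|b]; [exact: rnorm_ge0 | rewrite mulrC rnormM].
Qed.

Definition to_multiplier a : multiplier A :=
  @Multiplier R A (cmul a) (fun b : A => b ** a) (cmul_linearl a) (cmul_linearr a)
    (cmul_boundedl a) (cmul_boundedr a)
    (fun b c => cmulA a b c) (fun b c => esym (cmulA b c a)) (fun b c => cmulA b a c).

End MultiplierAlgebra.

Definition multiplier_extension (R : realType) (A B : cstarType R)
    (phi : A -> B) (phiM : multiplier A -> multiplier B) : Prop :=
  star_morphism phiM /\
  forall a, phiM (to_multiplier a) = to_multiplier (phi a).

(* [gmul x y] is meaningful only on composable pairs. Units are elements of the
   groupoid, and the source and range maps take their values in the groupoid;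
   their continuity follows from that of [ginv] and [gmul]. *)
Record groupoid (Xi : topologicalType) := Groupoid {
  src : Xi -> Xi ;
  rng : Xi -> Xi ;
  ginv : Xi -> Xi ;
  gmul : Xi -> Xi -> Xi ;
  src_src : forall x, src (src x) = src x ;
  rng_src : forall x, rng (src x) = src x ;
  src_rng : forall x, src (rng x) = rng x ;
  rng_rng : forall x, rng (rng x) = rng x ;
  src_mul : forall x y, src x = rng y -> src (gmul x y) = src y ;
  rng_mul : forall x y, src x = rng y -> rng (gmul x y) = rng x ;
  gmulA : forall x y z, src x = rng y -> src y = rng z ->
    gmul x (gmul y z) = gmul (gmul x y) z ;
  gmul_src : forall x, gmul x (src x) = x ;
  gmul_rng : forall x, gmul (rng x) x = x ;
  src_inv : forall x, src (ginv x) = rng x ;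
  rng_inv : forall x, rng (ginv x) = src x ;
  gmulV : forall x, gmul x (ginv x) = rng x ;
  gmulVl : forall x, gmul (ginv x) x = src x ;
  ginv_continuous : continuous ginv ;
  gmul_continuous : {within [set p : Xi * Xi | src p.1 = rng p.2],
    continuous (fun p : Xi * Xi => gmul p.1 p.2)}
}.

Definition sigma_compact (T : topologicalType) (S : set T) : Prop :=
  exists2 K : nat -> set T, forall n, compact (K n) & S = \bigcup_n K n.

Section Groupoid.
Context {Xi : topologicalType} (G : groupoid Xi).

Definition units : set Xi := [set x | src G x = x].

Definition composable : set (Xi * Xi) := [set p | src G p.1 = rng G p.2].

Definition fiber (x : Xi) : set Xi := src G @^-1` [set x].

Definition groupoid_orbit (x : Xi) : set Xi := rng G @` fiber x.

Definition invariant_set (A : set Xi) : Prop := forall x, A x -> groupoid_orbit x `<=` A.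

(* The groupoid $\Xi_A$; for $A = X$ this is the whole of $\Xi$. *)
Definition reduction (A : set Xi) : set Xi := src G @^-1` A.

End Groupoid.

(* Measurable types are pointed in the library. To allow an empty groupoid, the
   Borel space carries a base point [x], of which the measurable sets do not
   depend; it is available because the measures are indexed by points. *)
Definition borel (T : topologicalType) (x : T) : Type := T.

Section Borel.
Context {T : topologicalType} (x : T).

HB.instance Definition _ := Choice.on (borel x).
HB.instance Definition _ := isPointed.Build (borel x) x.

Definition borel_set : set (set (borel x)) := <<s @open T >>.

Lemma borel_setC (E : set (borel x)) : borel_set E -> borel_set (~` E).
Proof. by move=> sE; rewrite -setTD; exact: sigma_algebraCD. Qed.

HB.instance Definition _ := @isMeasurable.Build default_measure_display (borel x)
  borel_set (@sigma_algebra0 _ setT (@open T)) borel_setC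
  (@sigma_algebra_bigcup _ setT (@open T)).

End Borel.

Section Measures.
Context {R : realType} {T : topologicalType} {x : T}.
Variable mu : {measure set (borel x) -> \bar R}.

Definition regular_borel : Prop :=
  [/\ forall K : set T, compact K -> (mu K < +oo)%E,
      forall E : set (borel x), measurable E ->
        mu E = ereal_inf [set mu U | U in [set U : set T | open U /\ E `<=` U]]
    & forall U : set T, open U ->
        mu U = ereal_sup [set mu K | K in [set K : set T | compact K /\ K `<=` U]]].

Definition cintegral (D : set T) (f : T -> R[i]^o) : R[i]^o :=
  Complex (\int[mu]_(t in (D : set (borel x))) complex.Re (f t))
          (\int[mu]_(t in (D : set (borel x))) complex.Im (f t)).

Definition cmeasurable (D : set T) (f : T -> R[i]^o) : Prop :=
  measurable_fun (D : set (borel x)) (fun t : borel x => complex.Re (f t)) /\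
  measurable_fun (D : set (borel x)) (fun t : borel x => complex.Im (f t)).

Definition norm2 (D : set T) (f : T -> R[i]^o) : \bar R :=
  ('N[mu]_(2%:E)[(fun t : borel x => (complex.Re `|f t|)%:E) \_ (D : set (borel x))])%E.

End Measures.

(* $C_c(\Xi_A)$; its elements are represented by their extensions by zero. *)
Definition Cc (R : realType) (Xi : topologicalType) (G : groupoid Xi) (A : set Xi)
    (f : Xi -> R[i]^o) : Prop :=
  {within reduction G A, continuous f} /\
  exists K : set Xi, [/\ compact K, K `<=` reduction G A & forall x, ~ K x -> f x = 0].

(* The measure [haar x] on $\Xi_x$ is seen as a measure on $\Xi$ concentrated on
   $\Xi_x$; only its values at units [x] are relevant. *)
Record haar_system (R : realType) (Xi : topologicalType) (G : groupoid Xi) := HaarSystem {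
  haar :> forall x : Xi, {measure set (borel x) -> \bar R} ;
  haar_fiber : forall x, units G x -> haar x (~` fiber G x) = 0%E ;
  haar_regular : forall x, units G x -> regular_borel (haar x) ;
  haar_full_support : forall x, units G x -> forall U : set Xi, open U ->
    U `&` fiber G x !=set0 -> (0 < haar x U)%E ;
  haar_continuous : forall f : Xi -> R[i]^o, Cc G (units G) f ->
    {within units G, continuous (fun x => cintegral (haar x) (fiber G x) f : R[i]^o)} ;
  haar_invariant : forall (xi : Xi) (E : set (borel (src G xi))), measurable E ->
    haar (src G xi) E = haar (rng G xi) (fiber G (rng G xi) `&` [set eta | E (gmul G eta xi)])
}.

Record cocycle (R : realType) (Xi : topologicalType) (G : groupoid Xi) := Cocycle {
  cocycle_fun :> Xi -> Xi -> R[i]^o ;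
  cocycle_norm : forall x y, src G x = rng G y -> `|cocycle_fun x y| = 1 ;
  cocycle_continuous :
    {within composable G, continuous (fun p : Xi * Xi => cocycle_fun p.1 p.2)} ;
  cocycleP : forall x y z, src G x = rng G y -> src G y = rng G z ->
    cocycle_fun x y * cocycle_fun (gmul G x y) z =
    cocycle_fun y z * cocycle_fun x (gmul G y z) ;
  cocycle_unitl : forall x y, units G x -> rng G y = x -> cocycle_fun x y = 1 ;
  cocycle_unitr : forall x y, units G x -> src G y = x -> cocycle_fun y x = 1
}.

Section ReducedAlgebra.
Context {R : realType} {Xi : topologicalType} {G : groupoid Xi}.
Variables (lam : haar_system R G) (w : cocycle R G).
Implicit Types (f g u : Xi -> R[i]^o) (A : set Xi).

(* On functions vanishing off $\Xi_A$, with [A] invariant, these are the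
   operations attached to the restrictions of [lam] and [w] to $\Xi_A$. *)
Definition convolution f g : Xi -> R[i]^o := fun xi =>
  cintegral (lam (src G xi)) (fiber G (src G xi)) (fun eta =>
    f (gmul G xi (ginv G eta)) * g eta * w (gmul G xi (ginv G eta)) eta).

Definition conv_star f : Xi -> R[i]^o := fun xi =>
  (w xi (ginv G xi))^* * (f (ginv G xi))^*.

(* The operator norm of the regular representation $\Pi_x(f) : u \mapsto f\star_\omega u$
   on $L^2(\Xi_x;\lambda_x)$. *)
Definition regular_norm (x : Xi) f : \bar R :=
  ereal_sup [set norm2 (lam x) (fiber G x) (convolution f u) | u in
    [set u | cmeasurable (x := x) (fiber G x) u /\ (norm2 (lam x) (fiber G x) u <= 1)%E]].

(* Adjoining [0] only matters if [A] is empty. *)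
Definition reduced_norm A f : \bar R :=
  ereal_sup ([set 0%E] `|` [set regular_norm x f | x in A]).

(* [reduced_algebra A] is the type of the completions of $C_c(\Xi_A)$, that is,
   of the realizations of the C*-algebra of $(\Xi_A, \omega_A)$; only the values
   of [embed] on $C_c(\Xi_A)$ are relevant. *)
Record reduced_algebra A := ReducedAlgebra {
  completion :> cstarType R ;
  embed : (Xi -> R[i]^o) -> completion ;
  embed_linear : forall (l : R[i]) f g, Cc G A f -> Cc G A g ->
    embed (fun xi => l * f xi + g xi) = l *: embed f + embed g ;
  embed_conv : forall f g, Cc G A f -> Cc G A g ->
    embed (convolution f g) = embed f ** embed g ;
  embed_star : forall f, Cc G A f -> embed (conv_star f) = cstar (embed f) ;
  embed_norm : forall f, Cc G A f -> (complex.Re `|embed f|)%:E = reduced_norm A f ;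
  embed_dense : closure (embed @` Cc G A) = setT
}.

(* [f \_ (reduction G A)] is the restriction of [f], extended by zero. *)
Definition restriction_morphism A (C : reduced_algebra (units G)) (CA : reduced_algebra A)
    (rho : C -> CA) : Prop :=
  [/\ star_morphism rho, set_surj [set: C] [set: CA] rho &
      forall f, Cc G (units G) f -> rho (embed C f) = embed CA (f \_ (reduction G A))].

End ReducedAlgebra.

(* Main.v *)
(* For [x] in the invariant set [A] the regular representation at [x] only sees
   the values of [f] on the reduction to [A], so the reduced norm of [f] over [A]
   is at most that over [B]; hence [rhoA] factors as [theta \o rhoB]. A surjective
   star morphism extends to a unital star morphism of multiplier algebras, and
   the one extending [theta] maps [F_B] to [F_A].

   Star morphisms are not assumed bounded. The estimates come from writing a
   strict self-adjoint contraction [h] as the mean of the unitaries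
   [h +- i sqrt (1 - h^2)]: a unitary multiplier [u] satisfies
   [(u a)^* (u a) = a^* a], so [phi (u a)] and [phi a] have the same norm for
   every star morphism [phi]. *)

Require Import Defs.
From HB Require Import structures.
From mathcomp Require Import all_boot all_order all_algebra.
From mathcomp Require Import complex.
From mathcomp Require Import all_classical all_reals all_analysis.

Set Implicit Arguments.
Unset Strict Implicit.
Unset Printing Implicit Defensive.

Import Order.TTheory GRing.Theory Num.Theory.
Import numFieldNormedType.Exports.

Local Open Scope classical_set_scope.
Local Open Scope ring_scope.

(** * Strict self-adjoint contractions as means of unitaries *)

Section CstarNorm.
Local Open Scope complex_scope.
Local Open Scope cstar_scope.
Context {R : realType}.

Lemma rnormZ_real (V : normedModType R[i]) (t : R) (x : V) :
  0 <= t -> rnorm (t%:C *: x) = t * rnorm x.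
Proof. by move=> t0; rewrite rnormZ ger0_norm// ler0c. Qed.

(** Used to pass identities from the iterates of a contraction to their limit. *)
Lemma le_mul_eps_eq0 (V : normedModType R[i]) (M : R) (x : V) : 0 <= M ->
  (forall e : R, 0 < e -> rnorm x <= M * e) -> x = 0.
Proof.
move=> M0 xM; apply: rnorm0_eq0; apply/eqP; rewrite eq_le rnorm_ge0 andbT.
have M1 : 0 < M + 1 by rewrite ltr_wpDl.
apply/ler_addgt0Pl => e e0; rewrite addr0.
apply: (le_trans (xM _ (divr_gt0 e0 M1))).
by rewrite mulrCA ler_piMr ?ltW// ltr_pdivrMr// mul1r ltrDl.
Qed.

Section Half.
Context {A : cstarType R}.
Implicit Types h p q : A.

(** [p] and [q] need not commute, so the difference of squares is split as
    [p (p - q) + (p - q) q]. *)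
Lemma rnorm_sqrB p q :
  rnorm (p ** p - q ** q) <= (rnorm p + rnorm q) * rnorm (p - q).
Proof.
have -> : p ** p - q ** q = p ** (p - q) + (p - q) ** q.
  by rewrite cmulBr cmulBl addrA subrK.
rewrite (le_trans (rnormD _ _))// mulrDl lerD//; first exact: rnormM.
by rewrite [leRHS]mulrC rnormM.
Qed.

Lemma cstarB p q : cstar (p - q) = cstar p - cstar q.
Proof. by rewrite cstarD -scaleN1r cstarZ rmorphN1 scaleN1r. Qed.

(* The fixed point [p] of [p = (h^2 + p^2) / 2] is [1 - sqrt (1 - h^2)]. *)
Lemma half_sqr_fixpoint h : cstar h = h -> rnorm h < 1 ->
  exists p, [/\ cstar p = p, h ** p = p ** h & p + p = h ** h + p ** p].
Proof.
(* [s] is both the radius of a ball stable under [T], since [(s + s^2) / 2 <= s], and a Lipschitz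
   constant of [T] on that ball. *)
move=> hh h1; pose s := rnorm h ^+ 2.
have s0 : 0 <= s by exact: sqr_ge0.
have s1 : s < 1 by rewrite expr_lt1// rnorm_ge0.
pose T p := (2^-1)%:C *: (h ** h + p ** p).
have T2 p : T p + T p = h ** h + p ** p.
  have half1 : 2^-1 + 2^-1 = 1 :> R by rewrite [RHS]splitr !mul1r.
  by rewrite -scalerDl -rmorphD half1 scale1r.
pose u n := iter n T 0.
have half0 : 0 <= 2^-1 :> R by rewrite invr_ge0.
have un n : rnorm (u n) <= s.
  elim: n => [|n IH]; first by rewrite rnorm0.
  rewrite /= rnormZ_real// ler_pdivrMl//.
  rewrite (le_trans (rnormD _ _))// mulr_natl mulr2n lerD// ?(le_trans (rnormM _ _))//.
  by rewrite -[leRHS]mulr1 ler_pM ?rnorm_ge0 ?(le_trans IH)// ltW.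
have us n : cstar (u n) = u n.
  elim: n => [|n IH]; first by apply: rnorm0_eq0; rewrite rnorm_star rnorm0.
  rewrite /= /T cstarZ cstarD !cstarM hh IH; congr (_ *: _).
  exact: conjc_real.
have uh n : h ** u n = u n ** h.
  elim: n => [|n IH]; first by rewrite cmul0l cmul0r.
  by rewrite /= cmulZr cmulZl cmulDr cmulDl -!cmulA -IH !cmulA IH.
have TB p q : rnorm p <= s -> rnorm q <= s -> rnorm (T p - T q) <= s * rnorm (p - q).
  move=> ps qs; rewrite /T -scalerBr rnormZ_real// ler_pdivrMl//.
  rewrite opprD addrACA subrr add0r (le_trans (rnorm_sqrB _ _))// mulrA.
  by rewrite ler_wpM2r ?rnorm_ge0// mulr_natl mulr2n lerD.
(* Peeling off [n] applications of [T] leads back to [u 0 = 0], where [rnorm (u k) <= s <= 1]. *)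
have uB n k : rnorm (u (n + k)%N - u n) <= s ^+ n.
  elim: n => [|n IH].
    by rewrite add0n subr0 expr0 (le_trans (un _))// ltW.
  by rewrite addSn /= exprS (le_trans (TB _ _ _ _))// ler_wpM2l.
have [p up] : exists p, u @ \oo --> p.
  exists (lim (u @ \oo)); apply: cauchy_cvg; apply/cauchy_rnorm => e e0.
  have /cvgrPdist_lt/(_ _ e0)[N _ /(_ _ (leqnn N))] : (fun n => s ^+ n) @ \oo --> (0 : R).
    by apply: cvg_expr; rewrite ger0_norm.
  rewrite /= sub0r normrN ger0_norm; last exact: exprn_ge0.
  move=> sN.
  exists (u N), N => // m /= Nm; rewrite -rnormN opprB.
  by rewrite -(subnKC Nm) (le_lt_trans (uB _ _)).
(* Two consecutive iterates are needed, since [T (u n)] is [u n.+1]. *)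
have pu (e : R) : 0 < e -> exists2 n, rnorm (p - u n) < e & rnorm (p - u n.+1) < e.
  move=> e0; have /cvg_rnorm/(_ _ e0)[N _ Nu] := up.
  by exists N; apply: Nu => /=.
exists p; split.
- apply/eqP; rewrite -subr_eq0; apply/eqP.
  apply: (@le_mul_eps_eq0 _ 2) => // e /pu[n /ltW pn _].
  have -> : cstar p - p = cstar (p - u n) - (p - u n).
    by rewrite cstarB us opprB addrA subrK.
  by rewrite (le_trans (rnormD _ _))// rnormN rnorm_star mulr_natl mulr2n lerD.
- apply/eqP; rewrite -subr_eq0; apply/eqP.
  apply: (@le_mul_eps_eq0 _ (rnorm h *+ 2)); first by rewrite mulrn_wge0 ?rnorm_ge0.
  move=> e /pu[n /ltW pn _].
  have -> : h ** p - p ** h = h ** (p - u n) - (p - u n) ** h.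
    by rewrite cmulBr cmulBl uh opprB addrA subrK.
  rewrite (le_trans (rnormD _ _))// rnormN mulr2n mulrDl lerD//.
    by rewrite (le_trans (rnormM _ _))// ler_wpM2l ?rnorm_ge0.
  by rewrite (le_trans (rnormM _ _))// mulrC ler_wpM2l ?rnorm_ge0.
- rewrite -T2; suff -> : T p = p by [].
  apply/eqP; rewrite -subr_eq0; apply/eqP.
  (* [rnorm p + s] bounds the passage from [T p] to [T (u n)], the factor one half being dropped;
     [1] accounts for that from [u n.+1] to [p]. *)
  apply: (@le_mul_eps_eq0 _ (rnorm p + s + 1)).
    by rewrite !addr_ge0 ?rnorm_ge0.
  move=> e /pu[n /ltW pn /ltW pSn].
  rewrite -(subrK (T (u n)) (T p)) -addrA (le_trans (rnormD _ _))// mulrDl mul1r lerD//.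
    rewrite -scalerBr rnormZ_real// ler_pdivrMl//.
    rewrite opprD addrACA subrr add0r (le_trans (rnorm_sqrB _ _))//.
    rewrite mulr_natl mulr2n (@le_trans _ _ ((rnorm p + s) * e))//.
      by rewrite ler_pM ?addr_ge0 ?rnorm_ge0// lerD.
    by rewrite lerDl mulr_ge0 ?addr_ge0 ?rnorm_ge0// (le_trans _ pn)// rnorm_ge0.
  by rewrite -rnormN opprB.
Qed.

End Half.

(** One-sided unitarity is the relation behind [(u a)^* (u a) = a^* a]. *)
Definition isometry_elt (E : unitalCstarType R) (u : E) : Prop := cstar u ** u = cone.

Lemma cstar1 (E : unitalCstarType R) : cstar (cone : E) = cone.
Proof. by rewrite -[LHS]cmul1l -{1}[cone]cstarK -cstarM cmul1l cstarK. Qed.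

(** The fixed point [p] gives a self-adjoint [k = 1 - p] that commutes with [h] and satisfies
    [h^2 + k^2 = 1]; the cross terms of [(h + z k)^* (h + z k)] then cancel for [z = i] and
    [z = -i]. *)
Lemma selfadjoint_half_unitaries (E : unitalCstarType R) (h : E) :
  cstar h = h -> rnorm h < 1 ->
  exists u v : E, [/\ isometry_elt u, isometry_elt v & u + v = h + h].
Proof.
move=> hh /(half_sqr_fixpoint hh)[p [pp hp p2]].
pose k := cone - p.
have kk : cstar k = k.
  by rewrite /k cstarB cstar1 pp.
have hk : h ** k = k ** h by rewrite cmulBr cmulBl hp cmul1l cmul1r.
have k2 : h ** h + k ** k = cone.
  have -> : h ** h = p + p - p ** p by rewrite p2 addrK.
  rewrite /k cmulBr cmul1r cmulBl cmul1l opprB addrACA addKr addrACA subrr addr0.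
  by rewrite addrAC subrr add0r.
have iso (z : R[i]) : (z^*)%R = - z -> z * z = -1 -> isometry_elt (h + z *: k).
  move=> zc z2; rewrite /isometry_elt cstarD cstarZ hh kk zc cmulDl !cmulDr.
  rewrite !cmulZl !cmulZr scalerA mulNr z2 opprK scale1r hk scaleNr.
  by rewrite addrA addrK.
exists (h + 'i *: k), (h + (- 'i) *: k); split.
- apply: iso; last by rewrite -expr2 sqr_i.
  by rewrite -[LHS]/(conjc _); simpc.
- apply: iso; last by rewrite mulrNN -expr2 sqr_i.
  by rewrite -[LHS]/(conjc _); simpc.
- by rewrite addrACA -scalerDl subrr scale0r addr0.
Qed.

End CstarNorm.

(** * Star morphisms: contractivity and extension to multipliers *)

Section StarMorphism.
Local Open Scope complex_scope.
Local Open Scope cstar_scope.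
Context {R : realType}.

Section Multiplier.
Variable A : cstarType R.
Implicit Types (m n u : multiplier A) (a b : A).

(** The norm of a multiplier is that of its left action, so a zero left action forces a zero
    norm. *)
Lemma multiplier_eq m n : lmult m =1 lmult n -> m = n.
Proof.
move=> mn; apply/eqP; rewrite -subr_eq0; apply/eqP/rnorm0_eq0/eqP.
rewrite eq_le rnorm_ge0 andbT; apply: multiplier_norm_le => // a.
by rewrite lmultB mn subrr rnorm0 mul0r.
Qed.

(** In place of a unit, the difference is tested against its own adjoint:
    [(a - b) (a - b)^* = 0]. *)
Lemma to_multiplier_inj : injective (@to_multiplier R A).
Proof.
move=> a b ab; apply/eqP; rewrite -subr_eq0; apply/eqP/rnorm0_eq0/eqP.
have ab0 : (a - b) ** cstar (a - b) = 0.
  rewrite cmulBl; have := congr1 (fun m => lmult m (cstar (a - b))) ab.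
  by move=> /= ->; rewrite subrr.
by rewrite -sqrf_eq0 -rnorm_mul_star ab0 rnorm0.
Qed.

Lemma rnorm_to_multiplier a : rnorm (to_multiplier a) <= rnorm a.
Proof. by apply: multiplier_norm_le => [|b]; [exact: rnorm_ge0 | exact: rnormM]. Qed.

Lemma to_multiplier_lmult m a : to_multiplier (lmult m a) = m ** to_multiplier a.
Proof. by apply: multiplier_eq => b /=; rewrite lmultM. Qed.

Lemma rmult_lmult m a : rmult m a = cstar (lmult (cstar m) (cstar a)).
Proof. by rewrite /= !cstarK. Qed.

(** For the [A]-valued inner product [a^* b], the left action of [cstar m] is adjoint to that of
    [m]. *)
Lemma cstar_lmult_mul m a b :
  cstar (lmult m a) ** lmult m b = cstar (lmult (cstar m ** m) a) ** b.
Proof. by rewrite lrmult rmult_lmult cstarK. Qed.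

Lemma mul_lmult_star m a b : b ** lmult (cstar m) a = cstar (lmult m (cstar b)) ** a.
Proof. exact: lrmult. Qed.

End Multiplier.

Section Extension.
Variables (A B : cstarType R) (phi : A -> B).
Hypothesis phi_star : star_morphism phi.

Let phi_linear : linear phi. Proof. by case: phi_star. Qed.
Let phiM : {morph phi : a b / a ** b}. Proof. by case: phi_star. Qed.
Let phiS : {morph phi : a / cstar a}. Proof. by case: phi_star. Qed.

Lemma rnorm_morph_isometry (u : multiplier A) a :
  isometry_elt u -> rnorm (phi (lmult u a)) = rnorm (phi a).
Proof.
move=> uu; apply/eqP; rewrite -(@eqrXn2 _ 2) ?rnorm_ge0//.
rewrite -!rnorm_star_mul -!phiS -!phiM cstar_lmult_mul.
by rewrite (_ : cstar u ** u = cone).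
Qed.

(** The mean of unitaries handles [h = m^* m]; then [(m a)^* (m a) = (h a)^* a] and the C*-identity
    give the bound for [m] itself. *)
Lemma rnorm_morph_lmult_lt1 (m : multiplier A) a :
  rnorm m < 1 -> rnorm (phi (lmult m a)) <= rnorm (phi a).
Proof.
move=> m1; have [u [v [uu vv uv]]] : exists u v : multiplier A,
    [/\ isometry_elt u, isometry_elt v & u + v = cstar m ** m + cstar m ** m].
  apply: selfadjoint_half_unitaries; first by rewrite cstarM cstarK.
  by rewrite rnorm_star_mul expr_lt1// rnorm_ge0.
have hle : rnorm (phi (lmult (cstar m ** m) a)) <= rnorm (phi a).
  rewrite -(@ler_pM2l _ 2)// -rnormZ_real// rmorph_nat scaler_nat mulr2n.
  rewrite -(linear_mapD phi_linear) -lmultD -uv lmultD (linear_mapD phi_linear).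
  by rewrite (le_trans (rnormD _ _))// !rnorm_morph_isometry// mulr_natl mulr2n.
rewrite -(@ler_pXn2r _ 2) ?nnegrE ?rnorm_ge0//.
rewrite -rnorm_star_mul -phiS -phiM cstar_lmult_mul phiM phiS.
by rewrite (le_trans (rnormM _ _))// rnorm_star expr2 ler_wpM2r ?rnorm_ge0.
Qed.

Lemma rnorm_morph_lmult (m : multiplier A) a :
  rnorm (phi (lmult m a)) <= rnorm m * rnorm (phi a).
Proof.
(* Rescaling to a strict contraction requires [t] above the norm; [t] then decreases to it. *)
suff le (t : R) : rnorm m < t -> rnorm (phi (lmult m a)) <= t * rnorm (phi a).
  have [a0|a0] := eqVneq (rnorm (phi a)) 0.
    by have := le (rnorm m + 1); rewrite a0 !mulr0; apply; rewrite ltrDl.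
  have ap : 0 < rnorm (phi a) by rewrite lt_neqAle eq_sym a0 rnorm_ge0.
  rewrite -ler_pdivrMr//; apply/ler_addgt0Pl => e e0.
  by rewrite ler_pdivrMr// le// ltrDr.
move=> mt; have t0 : 0 < t by exact: le_lt_trans (rnorm_ge0 _) mt.
have ti0 : 0 <= t^-1 by rewrite invr_ge0 ltW.
rewrite -ler_pdivrMl// -rnormZ_real// -(linear_mapZ phi_linear) -lmultZ.
by apply: rnorm_morph_lmult_lt1; rewrite rnormZ_real// ltr_pdivrMl// mulr1.
Qed.

Lemma rnorm_morph a : rnorm (phi a) <= rnorm a.
Proof.
have [->|a0] := eqVneq (rnorm (phi a)) 0; first exact: rnorm_ge0.
have ap : 0 < rnorm (phi a) by rewrite lt_neqAle eq_sym a0 rnorm_ge0.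
rewrite -(ler_pM2r ap) -expr2 -rnorm_mul_star -phiS -phiM.
rewrite (le_trans (rnorm_morph_lmult (to_multiplier a) _))//.
by rewrite phiS rnorm_star ler_wpM2r ?rnorm_ge0 ?rnorm_to_multiplier.
Qed.

Lemma rnorm_morph_rmult (m : multiplier A) a :
  rnorm (phi (rmult m a)) <= rnorm m * rnorm (phi a).
Proof.
rewrite rmult_lmult phiS rnorm_star (le_trans (rnorm_morph_lmult _ _))//.
by rewrite phiS !rnorm_star.
Qed.

Hypothesis phi_surj : forall b, exists a, phi a = b.

(* [M] bounds [act] modulo the kernel of [phi], so [act] passes to [B], the quotient. *)
Lemma descend_map (act : A -> A) (M : R) : 0 <= M -> linear act ->
  (forall a, rnorm (phi (act a)) <= M * rnorm (phi a)) ->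
  exists f : B -> B, [/\ forall a, f (phi a) = phi (act a), linear f & bounded_map f].
Proof.
move=> M0 actl actM.
have [g gK] := choice phi_surj.
have fE a : phi (act (g (phi a))) = phi (act a).
  apply/eqP; rewrite -subr_eq0 -(linear_mapB phi_linear) -(linear_mapB actl).
  apply/eqP/rnorm0_eq0/eqP; rewrite eq_le rnorm_ge0 andbT.
  by rewrite (le_trans (actM _))// (linear_mapB phi_linear) gK subrr rnorm0 mulr0.
exists (fun b => phi (act (g b))); split=> //.
  by move=> l b c; have := fE (l *: g b + g c); rewrite phi_linear !gK actl phi_linear.
by apply/bounded_mapP; exists M => // b; rewrite -{2}[b]gK.
Qed.

Lemma multiplier_descends (m : multiplier A) :
  exists n : multiplier B, forall a, lmult n (phi a) = phi (lmult m a).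
Proof.
have [l [lE ll lb]] :=
  descend_map (rnorm_ge0 _) (@lmult_linear _ _ m) (rnorm_morph_lmult m).
have [r [rE rl rb]] :=
  descend_map (rnorm_ge0 _) (@rmult_linear _ _ m) (rnorm_morph_rmult m).
have lM b c : l (b ** c) = l b ** c.
  have [[a <-] [d <-]] := (phi_surj b, phi_surj c).
  by rewrite -phiM !lE lmultM phiM.
have rM b c : r (b ** c) = b ** r c.
  have [[a <-] [d <-]] := (phi_surj b, phi_surj c).
  by rewrite -phiM !rE rmultM phiM.
have lr b c : b ** l c = r b ** c.
  have [[a <-] [d <-]] := (phi_surj b, phi_surj c).
  by rewrite lE rE -!phiM lrmult.
by exists (Multiplier ll rl lb rb lM rM lr).
Qed.

(** As [phi] is onto, [Phi m] is determined by its action on the elements [phi a], where each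
    identity is checked. *)
Lemma surjective_morphism_extends : exists Phi : multiplier A -> multiplier B,
  unital_star_morphism Phi /\ forall m a, lmult (Phi m) (phi a) = phi (lmult m a).
Proof.
have [Phi PhiE] := choice multiplier_descends.
exists Phi; split=> //; have ext m n :
    (forall a, lmult m (phi a) = lmult n (phi a)) -> m = n.
  by move=> mn; apply: multiplier_eq => b; have [a <-] := phi_surj b.
split; last by apply: ext => a; rewrite PhiE.
split.
- move=> l m n; apply: ext => a.
  by rewrite lmultD lmultZ !PhiE lmultD lmultZ phi_linear.
- by move=> m n; apply: ext => a; rewrite /= !PhiE.
(* Moving adjoints across products shows that every [phi b] annihilates the difference [x]; taking
   [phi b = x^*] gives [x^* x = 0]. *)
- move=> m; apply: ext => a; apply/eqP; rewrite -subr_eq0.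
  set x := _ - _; apply/eqP/rnorm0_eq0/eqP.
  have x0 b : phi b ** x = 0.
    by rewrite /x cmulBr PhiE -phiM !mul_lmult_star -phiS PhiE -phiS -phiM subrr.
  have [b xb] := phi_surj (cstar x).
  by rewrite -sqrf_eq0 -rnorm_star_mul -xb x0 rnorm0.
Qed.

End Extension.

(** [A] is an ideal of its multiplier algebra, so [m a] lies in [A], where [phiM] is given by
    [phi]. *)
Lemma multiplier_extensionE (A B : cstarType R) (phi : A -> B)
    (phiM : multiplier A -> multiplier B) (m : multiplier A) a :
  multiplier_extension phi phiM -> lmult (phiM m) (phi a) = phi (lmult m a).
Proof.
move=> [[_ extM _] extE]; apply: to_multiplier_inj.
by rewrite to_multiplier_lmult -!extE -extM to_multiplier_lmult.
Qed.

(** The norm inequality puts the kernel of [phi] inside that of [psi], so [psi] factors through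
    [phi]; [Phi] extends the factor. *)
Lemma multiplier_factor (A B C : cstarType R) (phi : A -> B) (psi : A -> C)
    (phiM : multiplier A -> multiplier B) (psiM : multiplier A -> multiplier C) :
  star_morphism phi -> (forall b, exists a, phi a = b) ->
  star_morphism psi -> (forall c, exists a, psi a = c) ->
  (forall a, rnorm (psi a) <= rnorm (phi a)) ->
  multiplier_extension phi phiM -> multiplier_extension psi psiM ->
  exists Phi : multiplier B -> multiplier C,
    unital_star_morphism Phi /\ forall m, Phi (phiM m) = psiM m.
Proof.
move=> [phil phim phis] phisurj [psil psim psis] psisurj le phiext psiext.
have [g gK] := choice phisurj; pose theta b := psi (g b).
have thetaE a : theta (phi a) = psi a.
  apply/eqP; rewrite -subr_eq0 -(linear_mapB psil).
  apply/eqP/rnorm0_eq0/eqP; rewrite eq_le rnorm_ge0 andbT.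
  by rewrite (le_trans (le _))// (linear_mapB phil) gK subrr rnorm0.
have theta_star : star_morphism theta.
  split.
  - by move=> l b c; rewrite -[b]gK -[c]gK -phil !thetaE psil.
  - by move=> b c; rewrite -[b]gK -[c]gK -phim !thetaE psim.
  - by move=> b; rewrite -[b]gK -phis !thetaE psis.
have theta_surj c : exists b, theta b = c.
  by have [a <-] := psisurj c; exists (phi a).
have [Phi [Phiu PhiE]] := surjective_morphism_extends theta_star theta_surj.
exists Phi; split=> // m; apply: multiplier_eq => c; have [a <-] := psisurj c.
rewrite (multiplier_extensionE _ _ psiext) -{1}thetaE PhiE.
by rewrite (multiplier_extensionE _ _ phiext) thetaE.
Qed.

End StarMorphism.

(** * Reduced norms over closed invariant sets of units *)

Section Restriction.
Context {R : realType} {Xi : topologicalType} {G : groupoid Xi}.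
Implicit Types (f g : Xi -> R[i]^o) (A B : set Xi).

(** The source of [y] is [y^-1 y], and the pairs [(y^-1, y)] stay among the composable ones, where
    multiplication is continuous. *)
Lemma src_continuous : continuous (src G).
Proof.
move=> x; have -> : src G = (fun p => gmul G p.1 p.2) \o (fun y => (ginv G y, y)).
  by apply/funext => y /=; rewrite gmulVl.
have /subspace_continuousP/(_ (ginv G x, x)) := @gmul_continuous _ G.
move=> /(_ (src_inv G x)) gc; apply: (cvg_comp _ _ _ gc).
have pc : (ginv G y, y) @[y --> x] --> (ginv G x, x).
  by apply: cvg_pair; [exact: ginv_continuous | exact: cvg_id].
move=> P wP; suff : \forall y \near x, P (ginv G y, y) by [].
have : \forall y \near x, src G (ginv G y) = rng G y -> P (ginv G y, y) by exact: pc wP.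
by apply: filterS => y; apply; exact: src_inv.
Qed.

Lemma reduction_units : reduction G (units G) = setT.
Proof. by apply/seteqP; split=> // x _; exact: src_src. Qed.

(** Closedness of [A] makes its reduction closed, so the support stays compact after
    intersection. *)
Lemma Cc_restriction A f : closed A -> Cc G (units G) f ->
  Cc G A (f \_ (reduction G A)).
Proof.
move=> Acl [fc [K [Kc _ Kf]]].
have redcl : closed (reduction G A).
  by apply: closed_comp => // x _; exact: src_continuous.
split.
  apply: (@subspace_eq_continuous _ _ _ f).
    by move=> x xA; apply/esym; exact: ifT.
  by apply: continuous_subspaceW fc => x _; rewrite reduction_units.
exists (K `&` reduction G A); split.
- exact: compact_closedI.
- by move=> x [].
- move=> x xK; rewrite patchE; case: ifPn => // /set_mem xA.
  by apply: Kf => Kx; exact: xK.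
Qed.

Variables (lam : haar_system R G) (w : cocycle R G).

(* For [x] in the invariant set [A], the fibre over [x] lies in the reduction to [A]. *)
Lemma regular_norm_restriction A f g x : A `<=` units G -> invariant_set G A -> A x ->
  {in reduction G A, f =1 g} ->
  regular_norm lam w x f = regular_norm lam w x g.
Proof.
move=> Au Ai Ax fg; rewrite /regular_norm; congr ereal_sup.
apply: eq_imagel => u _; rewrite /norm2; congr Lnorm; apply/funext => t.
rewrite !patchE; case: ifPn => // /set_mem tx.
congr (_%:E); congr (complex.Re `|_|); rewrite /convolution tx.
(* The source of [t eta^-1] is the range of [eta], a point of the orbit of [x]. *)
have fgE eta : fiber G x eta ->
    f (gmul G t (ginv G eta)) = g (gmul G t (ginv G eta)).
  move=> ex; apply: fg; apply/mem_set; rewrite /reduction /= src_mul ?src_inv.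
    by apply: (Ai _ Ax); exists eta.
  by rewrite rng_inv tx ex.
by congr Complex; apply: eq_Rintegral => eta /set_mem/fgE ->.
Qed.

(** Over points of [A] both restrictions have the same regular norm, so the left supremum runs over
    part of the right one. *)
Lemma reduced_norm_restriction A B f : A `<=` units G -> invariant_set G A -> A `<=` B ->
  (reduced_norm lam w A (f \_ (reduction G A)) <=
   reduced_norm lam w B (f \_ (reduction G B)))%E.
Proof.
move=> Au Ai AB; apply: le_ereal_sup => _ [->|[x Ax <-]]; first by left.
right; exists x; first exact: AB.
apply/esym/(regular_norm_restriction Au Ai Ax) => y yA.
rewrite !patchE yA mem_set//; apply: AB; exact: set_mem yA.
Qed.

(** The inequality of reduced norms holds on the dense image of [Cc] and passes to the limit because
    star morphisms are contractive. *)
Lemma rnorm_restriction_le A B (C : reduced_algebra lam w (units G))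
    (CA : reduced_algebra lam w A) (CB : reduced_algebra lam w B)
    (rhoA : C -> CA) (rhoB : C -> CB) :
  A `<=` units G -> closed A -> invariant_set G A -> closed B -> A `<=` B ->
  restriction_morphism rhoA -> restriction_morphism rhoB ->
  forall c, rnorm (rhoA c) <= rnorm (rhoB c).
Proof.
move=> Au Acl Ai Bcl AB [rA _ rAE] [rB _ rBE] c.
have [[rAl _ _] [rBl _ _]] := (rA, rB).
have le_embed f : Cc G (units G) f ->
    rnorm (rhoA (embed C f)) <= rnorm (rhoB (embed C f)).
  move=> fC; rewrite -lee_fin rAE// rBE// /rnorm !embed_norm.
  - exact: reduced_norm_restriction.
  - exact: Cc_restriction.
  - exact: Cc_restriction.
(* One half of [e] is spent on [rhoA], the other on [rhoB]. *)
apply/ler_addgt0Pl => e e0; have e2 : 0 < e / 2 by exact: divr_gt0.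
have [_ [[f fC <-] /rnorm_ball cf]] :
    (embed C @` Cc G (units G)) `&` ball c (e / 2)%:C%C !=set0.
  have : closure (embed C @` Cc G (units G)) c by rewrite embed_dense.
  by apply; apply: nbhsx_ballx; rewrite ltcR.
have close (D : cstarType R) (rho : C -> D) : star_morphism rho ->
    rnorm (rho c - rho (embed C f)) <= e / 2.
  move=> rho_star; have [rhol _ _] := rho_star.
  rewrite -(linear_mapB rhol) (le_trans (rnorm_morph rho_star _))//.
  exact: ltW.
rewrite -(subrK (rhoA (embed C f)) (rhoA c)) (le_trans (rnormD _ _))//.
rewrite [e]splitr -addrA lerD ?close// (le_trans (le_embed f fC))//.
rewrite -{1}(subrK (rhoB c) (rhoB (embed C f))) (le_trans (rnormD _ _))//.
by rewrite lerD// -rnormN opprB close.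
Qed.

End Restriction.

Theorem proposition3p1 (R : realType) (Xi : topologicalType)
  (Xi_hausdorff : hausdorff_space Xi)
  (Xi_locally_compact : locally_compact [set: Xi])
  (Xi_sigma_compact : sigma_compact [set: Xi])
  (G : groupoid Xi) (lam : haar_system R G) (w : cocycle R G)
  (Sigma : spectral_set R)
  (C : reduced_algebra lam w (units G)) (F : multiplier C)
  (A B : set Xi)
  (A_units : A `<=` units G) (A_closed : closed A) (A_invariant : invariant_set G A)
  (B_units : B `<=` units G) (B_closed : closed B) (B_invariant : invariant_set G B)
  (AB : A `<=` B)
  (CA : reduced_algebra lam w A) (CB : reduced_algebra lam w B)
  (rhoA : C -> CA) (rhoA_restr : restriction_morphism rhoA)
  (rhoB : C -> CB) (rhoB_restr : restriction_morphism rhoB)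
  (rhoAM : multiplier C -> multiplier CA) (rhoAM_ext : multiplier_extension rhoA rhoAM)
  (rhoBM : multiplier C -> multiplier CB) (rhoBM_ext : multiplier_extension rhoB rhoBM) :
  Sigma (multiplier CA) (rhoAM F) `<=` Sigma (multiplier CB) (rhoBM F).
Proof.
have [rA surjA _] := rhoA_restr; have [rB surjB _] := rhoB_restr.
have surj (D : cstarType R) (rho : C -> D) :
    set_surj [set: C] [set: D] rho -> forall b, exists a, rho a = b.
  by move=> rs b; have [a _ <-] := rs b I; exists a.
have le := rnorm_restriction_le A_units A_closed A_invariant B_closed AB
  rhoA_restr rhoB_restr.
have [Phi [Phi_unital PhiE]] := multiplier_factor rB (surj _ _ surjB) rA
  (surj _ _ surjA) le rhoBM_ext rhoAM_ext.
by rewrite -PhiE; exact: spectrum_morphism.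
Qed.
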